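(* Let $\mathscr A$ be a strongly subconvex $L^q$-set with $q>1$ and $\mathscr B$ a strongly subconvex $L^r$-set with $r>1$, and define $p$ by $\frac1p=\frac1q+\frac1r-1$. Suppose that $\mathscr A\cap\mathscr B$ has positive lower density and that $\frac32<\frac1q+\frac1r<2$. Then $\mathscr A\cap\mathscr B$ is a strongly subconvex $L^p$-set.
   Context: For $\mathscr D\subseteq\mathbb N$ write $\mathscr D(N)=\mathscr D\cap[1,N]$, $D(N)=\mathrm{card}(\mathscr D(N))$, $e(z)=e^{2\pi iz}$ and $I_p(N;\mathscr D)=\int_0^1|\sum_{n\in\mathscr D(N)}e(n\alpha)|^p\,d\alpha$. A non-empty $\mathscr D\subseteq\mathbb N$ is a strongly subconvex $L^p$-set if $0<p<2$ and for all $N$ sufficiently large in terms of $p$, $I_p(N;\mathscr D)\ll N^{-1}D(N)^p$ with implied constant independent of $N$. Positive lower density means $\liminf_{N\to\infty}D(N)/N>0$. *)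

(* Defs.v *)
From mathcomp Require Import all_boot all_order all_algebra finmap complex.
From mathcomp Require Import all_classical all_reals all_analysis.

Set Implicit Arguments.
Unset Strict Implicit.
Unset Printing Implicit Defensive.

Import Order.TTheory GRing.Theory Num.Theory.
Import numFieldNormedType.Exports.

Local Open Scope classical_set_scope.
Local Open Scope ring_scope.

(* D ∩ [1, N]; the integer 0 is never counted, so it does not matter for the
   counting function and the moments below whether 0 belongs to D. *)
Definition trunc (D : set nat) (N : nat) : {fset nat} :=
  [fset n : nat in iota 1 N | n \in D]%fset.

Definition counting_fun (D : set nat) (N : nat) : nat := #|` trunc D N|%fset.

(* e^(2 pi i x) at a real point x, written with Euler's formula since the
   library has no exponential on R[i]. *)
Definition e (R : realType) (x : R) : R[i] :=
  Complex (cos (2 * pi * x)) (sin (2 * pi * x)).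

Definition exp_sum (R : realType) (D : set nat) (N : nat) (alpha : R) : R[i] :=
  \sum_(n <- trunc D N) e (n%:R * alpha).

(* Normc.normc is the R-valued modulus; the integral is the extended-real
   Lebesgue integral, so no integrability side condition is hidden in it. *)
Definition moment (R : realType) (p : R) (D : set nat) (N : nat) : \bar R :=
  \int[@lebesgue_measure R]_(alpha in `[0, 1])
    ((Normc.normc (exp_sum D N alpha)) `^ p)%:E.

Definition strongly_subconvex (R : realType) (p : R) (D : set nat) : Prop :=
  [/\ D !=set0,
      0 < p < 2
    & exists2 C : R, 0 < C &
      \forall N \near \oo,
        (moment p D N <=
           (C * N%:R^-1 * (counting_fun D N)%:R `^ p)%:E)%E].

Definition positive_lower_density (R : realType) (D : set nat) : Prop :=
  (0 < limn_einf (fun N : nat =>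
         ((counting_fun D N)%:R / N%:R : R)%:E))%E.

(* Main.v *)
(** On the circle, the exponential sum of A ∩ B is the convolution of those of
    A and B, so Young's inequality gives
      I_p(A ∩ B) <= I_q(A)^(p/q) I_r(B)^(p/r) << N^(-1-p) A(N)^p B(N)^p,
    because p/q + p/r = 1 + p; positive density turns the trivial bounds
    A(N), B(N) <= N << (A ∩ B)(N) into the claim.  Young's inequality is
    proved on the finite group Z/M, where for M > N the convolution identity is the
    orthogonality of the M-th roots of unity, and then carried over to the
    circle by letting M tend to infinity: the discrete moments are Riemann sums
    of Lipschitz functions. *)

Require Import Defs.
From mathcomp Require Import all_boot all_order all_algebra.
From mathcomp Require Import finmap complex.
From mathcomp Require Import all_classical all_reals all_analysis.
From mathcomp Require Import ring lra.

Import Order.TTheory GRing.Theory Num.Theory.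
Import numFieldNormedType.Exports.

Local Open Scope classical_set_scope.
Local Open Scope ring_scope.

(** * Inequalities for real powers: weighted AM-GM, Hoelder for finite sums, Lipschitz bounds *)

Lemma powR_AMGM {R : realType} {s t a b : R} : 0 < s -> 0 < t -> s + t = 1 ->
  0 <= a -> 0 <= b -> a `^ s * b `^ t <= s * a + t * b.
Proof.
move=> s0 t0 st a0 b0.
have := @conjugate_powR R (a `^ s) (b `^ t) s^-1 t^-1.
rewrite !invr_gt0 !invrK -!powRrM !mulfV ?gt_eqF// !powRr1//.
by rewrite [a * s]mulrC [b * t]mulrC; apply => //; exact: powR_ge0.
Qed.

(** Weighted AM-GM is applied termwise to the normalised values [f i / F] and [g i / G], and the
    weights then sum to [s + t = 1]. A vanishing total, where normalising is impossible, forces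
    every term to vanish because [s] and [t] are nonzero. *)
Lemma sum_hoelder {R : realType} {I : finType} {f g : I -> R} {s t : R} :
  0 < s -> 0 < t -> s + t = 1 ->
  (forall i, 0 <= f i) -> (forall i, 0 <= g i) ->
  \sum_i f i `^ s * g i `^ t <= (\sum_i f i) `^ s * (\sum_i g i) `^ t.
Proof.
move=> s0 t0 st f0 g0; set F := \sum_i f i; set G := \sum_i g i.
have F0 : 0 <= F by exact: sumr_ge0.
have G0 : 0 <= G by exact: sumr_ge0.
have [FE|Fn] := eqVneq F 0.
  rewrite big1 ?mulr_ge0 ?powR_ge0// => i _.
  move/eqP : FE; rewrite /F psumr_eq0 => [|//] /allP/(_ i).
  by rewrite mem_index_enum => /(_ isT)/eqP ->; rewrite powR0 ?gt_eqF// mul0r.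
have [GE|Gn] := eqVneq G 0.
  rewrite big1 ?mulr_ge0 ?powR_ge0// => i _.
  move/eqP : GE; rewrite /G psumr_eq0 => [|//] /allP/(_ i).
  by rewrite mem_index_enum => /(_ isT)/eqP ->; rewrite powR0 ?gt_eqF// mulr0.
have Fp : 0 < F by rewrite lt_def Fn.
have Gp : 0 < G by rewrite lt_def Gn.
have FGp : 0 < F `^ s * G `^ t by rewrite mulr_gt0 ?powR_gt0.
have key i : f i `^ s * g i `^ t
    <= F `^ s * G `^ t * (s * (f i / F) + t * (g i / G)).
  have := powR_AMGM s0 t0 st (divr_ge0 (f0 i) F0) (divr_ge0 (g0 i) G0).
  move/(ler_wpM2l (ltW FGp)); apply: le_trans.
  rewrite mulrACA -!powRM ?divr_ge0//.
  by rewrite ![_ * (_ / _)]mulrC !divfK.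
apply: le_trans (ler_sum _ (fun i _ => key i)) _.
rewrite -mulr_sumr big_split/= -!mulr_sumr -!mulr_suml -/F -/G !divff//.
by rewrite !mulr1 st mulr1.
Qed.

(** Two-function Hoelder is used twice: with exponents [s] and [t + u], where [g] and [h] are merged
    into [k], then on [k] with exponents [t / (t + u)] and [u / (t + u)]. *)
Lemma sum_hoelder3 {R : realType} {I : finType} {f g h : I -> R} {s t u : R} :
  0 < s -> 0 < t -> 0 < u -> s + t + u = 1 ->
  (forall i, 0 <= f i) -> (forall i, 0 <= g i) -> (forall i, 0 <= h i) ->
  \sum_i f i `^ s * g i `^ t * h i `^ u
    <= (\sum_i f i) `^ s * (\sum_i g i) `^ t * (\sum_i h i) `^ u.
Proof.
move=> s0 t0 u0 stu f0 g0 h0; have tu0 : 0 < t + u by rewrite addr_gt0.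
have tuE : t / (t + u) + u / (t + u) = 1 by rewrite -mulrDl divff ?gt_eqF.
have powRE (x v : R) : (x `^ (v / (t + u))) `^ (t + u) = x `^ v.
  by rewrite -powRrM divfK ?gt_eqF.
pose k i := g i `^ (t / (t + u)) * h i `^ (u / (t + u)).
have k0 i : 0 <= k i by rewrite mulr_ge0 ?powR_ge0.
rewrite (eq_bigr (fun i => f i `^ s * k i `^ (t + u))); last first.
  by move=> i _; rewrite powRM ?powR_ge0// !powRE mulrA.
apply: le_trans (sum_hoelder s0 tu0 _ f0 k0) _; first by rewrite addrA.
rewrite -mulrA ler_wpM2l ?powR_ge0//.
rewrite -[_ `^ t]powRE -[_ `^ u]powRE -powRM ?powR_ge0//.
rewrite ge0_ler_powR ?nnegrE ?mulr_ge0 ?powR_ge0 ?sumr_ge0// ?(ltW tu0)//.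
by apply: sum_hoelder => //; rewrite divr_gt0.
Qed.

(* Weighted AM-GM for [x `^ p] and [y `^ p] with weights [1 - p^-1] and [p^-1]
   gives [p x^(p-1) y <= (p - 1) x^p + y^p], which is the claim. *)
Lemma powR_sub_le {R : realType} {p x y : R} : 1 < p -> 0 <= y <= x ->
  x `^ p - y `^ p <= p * x `^ (p - 1) * (x - y).
Proof.
move=> p1 /andP[y0 yx]; have x0 := le_trans y0 yx.
have p0 : 0 < p by apply: lt_trans p1.
have pn0 : p != 0 by rewrite gt_eqF.
have q0 : 0 < 1 - p^-1 by rewrite subr_gt0 invf_lt1.
have := powR_AMGM q0 (_ : 0 < p^-1) (subrK _ _) (powR_ge0 x p) (powR_ge0 y p).
rewrite invr_gt0 => /(_ p0); rewrite -!powRrM mulfV// powRr1//.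
rewrite mulrBr mulr1 mulfV//.
rewrite -(mulr_powRB1 x0 p0); set X := x `^ (p - 1); set Y := y `^ p.
move/(ler_wpM2l (ltW p0)).
rewrite mulrDr !mulrA mulrBr mulfV// mulr1 mul1r => H.
lra.
Qed.

Lemma lipschitz_powR {R : realType} {p K L : R} {f : R -> R} : 1 < p ->
  (forall x, 0 <= f x <= K) -> (forall x y, `|f x - f y| <= L * `|x - y|) ->
  forall x y, `|f x `^ p - f y `^ p| <= p * K `^ (p - 1) * L * `|x - y|.
Proof.
move=> p1 fK fL x y; wlog : x y / f y <= f x.
  by move=> H; have /orP[/H|/H//] := le_total (f y) (f x);
    rewrite distrC (distrC x).
move=> yx; have [/andP[x0 xK] /andP[y0 yK]] := (fK x, fK y).
have p0 : 0 < p by apply: lt_trans p1.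
rewrite ger0_norm; last by rewrite subr_ge0 ge0_ler_powR ?nnegrE ?(ltW p0).
have h : f x `^ p - f y `^ p <= p * f x `^ (p - 1) * (f x - f y).
  by apply: powR_sub_le => //; apply/andP.
apply: le_trans h _.
rewrite -[leRHS]mulrA ler_pM ?mulr_ge0 ?powR_ge0 ?subr_ge0 ?(ltW p0)//.
  by rewrite ler_pM2l// ge0_ler_powR ?nnegrE ?subr_ge0 ?(ltW p1)// (le_trans x0).
by apply: le_trans (fL x y); exact: ler_norm.
Qed.

(** * Riemann sums of Lipschitz functions on the unit interval *)

(** Left endpoints are sampled, so that for a 1-periodic [g] this is also the average of [g] over
    the copy of Z/M in the circle. *)
Definition riemann_sum {R : realType} (g : R -> R) (M : nat) : R :=
  M%:R^-1 * \sum_(k < M) g (k%:R / M%:R).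

Section riemann.
Context {R : realType} {g : R -> R} {L : R}.
Hypothesis gL : forall x y, `|g x - g y| <= L * `|x - y|.
Notation mu := (@lebesgue_measure R).

Let L0 : 0 <= L.
Proof.
by have := gL 0 1; rewrite sub0r normrN normr1 mulr1; exact: le_trans.
Qed.

Lemma lipschitz_continuous : continuous g.
Proof.
move=> x; apply/cvgrPdist_le => /= eps eps0; near=> y.
apply: le_trans (gL x y) _.
(* Enlarging [L] to [L + 1] allows division when [L = 0]. *)
apply: (@le_trans _ _ ((L + 1) * `|x - y|)); first by rewrite ler_wpM2r// lerDl.
rewrite -ler_pdivlMl ?ltr_wpDl// mulrC.
near: y; apply: cvgr_dist_le; last by rewrite divr_gt0// ltr_wpDl.
exact: cvg_id.
Unshelve. all: by end_near. Qed.

Lemma lipschitz_integrable (a b : R) : mu.-integrable `[a, b] (EFin \o g).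
Proof.
apply: continuous_compact_integrable; first exact: segment_compact.
by apply: continuous_subspaceT; exact: lipschitz_continuous.
Qed.

Lemma Rintegral_left_endpoint (a b : R) : a <= b ->
  `|\int[mu]_(x in `]a, b]) g x - (b - a) * g a| <= L * (b - a) ^+ 2.
Proof.
move=> ab.
have ig : mu.-integrable `]a, b] (EFin \o g).
  apply: integrableS (lipschitz_integrable a b) => //.
  exact: subset_itv_oc_cc.
have ic (c : R) : mu.-integrable `]a, b] (EFin \o cst c).
  apply: integrableS (_ : mu.-integrable `[a, b] (EFin \o cst c)) => //.
    exact: subset_itv_oc_cc.
  apply: continuous_compact_integrable; first exact: segment_compact.
  by apply: continuous_subspaceT => x; exact: cvg_cst.
have cE (c : R) : \int[mu]_(x in `]a, b]) c = (b - a) * c.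
  rewrite Rintegral_cst// mulrC; congr (_ * _).
  rewrite [X in fine X](_ : _ = mu `]a, b]%classic)//.
  rewrite lebesgue_measure_itv/= lte_fin.
  case: ifPn => [//|]; rewrite -leNgt => ba.
  by rewrite (@le_anti _ _ a b) ?ab// subrr.
have gd x : `]a, b]%classic x -> `|g x - g a| <= L * (b - a).
  rewrite /= in_itv/= => /andP[ax xb]; apply: le_trans (gL _ _) _.
  by rewrite ler_wpM2l// gtr0_norm ?subr_gt0// lerB.
rewrite ler_distl; apply/andP; split.
- rewrite (_ : _ - _ = (b - a) * (g a - L * (b - a))); last by ring.
  rewrite -cE; apply: le_Rintegral => // [|x /gd]; first exact: ic.
  by rewrite ler_distl => /andP[].
- rewrite (_ : _ + _ = (b - a) * (g a + L * (b - a))); last by ring.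
  rewrite -cE; apply: le_Rintegral => // [|x /gd]; first exact: ic.
  by rewrite ler_distl => /andP[].
Qed.

(** The integral telescopes over the [M] cells of length [1 / M]; each cell has error at most
    [L / M ^ 2]. *)
Lemma riemann_sum_dist (M : nat) : (0 < M)%N ->
  `|\int[mu]_(x in `[0, 1]) g x - riemann_sum g M| <= L / M%:R.
Proof.
move=> M0; have Mr0 : (0 : R) < M%:R by rewrite ltr0n.
pose t (k : nat) : R := k%:R / M%:R.
have tS k : t k.+1 - t k = M%:R^-1.
  by rewrite /t -mulrBl -natr1 addrAC subrr add0r mul1r.
pose I k := \int[mu]_(x in `[0, t k]) g x.
have IS k : I k.+1 - I k = \int[mu]_(x in `]t k, t k.+1]) g x.
  apply: Rintegral_itvB; first exact: lipschitz_integrable.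
    by rewrite bnd_simp divr_ge0.
  by rewrite bnd_simp -subr_ge0 tS invr_ge0.
have I0 : I 0%N = 0.
  by rewrite /I /t mul0r set_itv1 Rintegral_set1.
have -> : \int[mu]_(x in `[0, 1]) g x = \sum_(k < M) (I k.+1 - I k).
  by rewrite -(big_mkord xpredT (fun k => I k.+1 - I k)) telescope_sumr//
    I0 subr0 /I /t divff ?gt_eqF.
rewrite /riemann_sum mulr_sumr -sumrB.
apply: le_trans (ler_norm_sum _ _ _) _.
apply: (@le_trans _ _ (\sum_(k < M) L / M%:R ^+ 2)).
  apply: ler_sum => k _; rewrite IS -exprVn.
  have /Rintegral_left_endpoint : t k <= t k.+1 by rewrite -subr_ge0 tS invr_ge0.
  by rewrite tS.
by rewrite sumr_const card_ord -[leLHS]mulr_natr expr2 invfM mulrA divfK ?gt_eqF.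
Qed.

Lemma riemann_sum_cvg :
  riemann_sum g M @[M --> \oo] --> \int[mu]_(x in `[0, 1]) g x.
Proof.
apply/cvgrPdist_le => /= eps eps0; near=> M.
have M0 : (0 < M)%N by near: M; exact: nbhs_infty_gt.
apply: le_trans (riemann_sum_dist M M0) _.
rewrite ler_pdivrMr ?ltr0n// mulrC -ler_pdivrMr//.
by near: M; exact: nbhs_infty_ger.
Unshelve. all: by end_near. Qed.

End riemann.

(** * Roots of unity, convolution and Young's inequality on Z/(n+1) *)

Lemma sum_expr_root1 {F : fieldType} {n : nat} {w : F} :
  w ^+ n = 1 -> w != 1 -> \sum_(i < n) w ^+ i = 0.
Proof.
move=> wn w1; have /esym/eqP := subrX1 w n.
by rewrite wn subrr mulf_eq0 subr_eq0 (negPf w1) /= => /eqP.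
Qed.

(** Here [k - j] is subtraction modulo [n.+1], which is harmless because exponents of [z] matter
    only modulo [n.+1]. *)
Lemma prim_expr_sub {F : fieldType} {n : nat} {z : F} (k j : 'I_n.+1) (m : nat) :
  n.+1.-primitive_root z ->
  z ^+ (m * (k - j)%R) = z ^+ (m * k) * (z ^+ m)^-1 ^+ j.
Proof.
move=> hz; have z0 : z != 0.
  apply/eqP => z0; have := prim_expr_order hz.
  by rewrite z0 expr0n/= => /eqP; rewrite eq_sym oner_eq0.
apply: (@mulIf _ (z ^+ (m * j))); first by rewrite expf_neq0.
rewrite -mulrA exprVn -[X in _ = _ * (X^-1 * _)]exprM mulVf ?expf_neq0// mulr1.
rewrite -exprD; apply/eqP; rewrite (eq_prim_root_expr hz) -mulnDr.
have kE : (((k - j)%R + j) %% n.+1)%N = k by rewrite -[in RHS](subrK j k).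
by rewrite -[in X in _ == X]kE modnMmr.
Qed.

(** After expanding, the sum over [j] is geometric with ratio [z ^+ a / z ^+ b], an [n.+1]-th root
    of unity. It vanishes unless [a = b], so only indices satisfying both [P] and [Q] survive. *)
Lemma root_unity_convolution {F : fieldType} {n : nat} {z : F} {s : seq nat}
    {P Q : pred nat} (k : 'I_n.+1) :
  n.+1.-primitive_root z -> uniq s -> {in s, forall i, (i <= n)%N} ->
  \sum_(j < n.+1) (\sum_(a <- s | P a) z ^+ (a * j))
                * (\sum_(b <- s | Q b) z ^+ (b * (k - j)%R))
  = n.+1%:R * \sum_(a <- s | P a && Q a) z ^+ (a * k).
Proof.
move=> hz us sn.
have key a b : a \in s -> b \in s ->
    \sum_(j < n.+1) z ^+ (a * j) * z ^+ (b * (k - j)%R)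
    = if b == a then n.+1%:R * z ^+ (a * k) else 0.
  move=> sa sb.
  rewrite (eq_bigr (fun j : 'I_n.+1 => z ^+ (b * k) * (z ^+ a / z ^+ b) ^+ j)).
    rewrite -mulr_sumr; case: eqP => [->|/eqP ba].
      rewrite divff; last first.
        apply/eqP => z0; have /eqP := congr1 (fun x => x ^+ n.+1) z0.
        by rewrite exprAC (prim_expr_order hz) expr1n expr0n/= oner_eq0.
      by under eq_bigr do rewrite expr1n; rewrite sumr_const card_ord mulrC.
    rewrite sum_expr_root1 ?mulr0//.
      rewrite expr_div_n !(exprAC _ _ n.+1) (prim_expr_order hz) !expr1n divr1//.
    (* Ratio 1 would make [a] and [b] congruent modulo [n.+1], hence equal, as both are at most
       [n]. *)
    apply: contra ba => /eqP H.
    have : z ^+ a == z ^+ b.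
      rewrite -[z ^+ a](@divfK _ (z ^+ b)) ?H ?mul1r//.
      by apply/eqP => b0; move: H; rewrite b0 invr0 mulr0 => /eqP;
        rewrite eq_sym oner_eq0.
    by rewrite (eq_prim_root_expr hz) !modn_small ?ltnS ?sn// eq_sym.
  by move=> j _; rewrite prim_expr_sub// mulrCA exprMn (exprM z a).
under eq_bigr do rewrite big_distrlr.
rewrite exchange_big/= big_mkcond/= mulr_sumr big_mkcondr/=.
rewrite [RHS]big_mkcond/=.
rewrite !big_seq; apply: eq_bigr => a sa; case: ifPn => // Pa.
rewrite exchange_big/= big_seq_cond.
under eq_bigr => b /andP[sb _] do rewrite key//.
rewrite -big_seq_cond -big_mkcondr/=.
case: ifPn => Qa.
  rewrite (eq_bigl (pred1 a)); last first.
    by move=> b /=; case: eqP => [->|]; rewrite ?Qa ?andbF.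
  by rewrite -big_filter filter_pred1_uniq// big_seq1.
by rewrite big1// => b /andP[Qb /eqP ba]; rewrite ba (negPf Qa) in Qb.
Qed.

(* Hoelder with exponents [1/p], [1/q - 1/p] and [1/r - 1/p], which sum to [1],
   applied to the factorisation
   [F G = (F^q G^r)^(1/p) (F^q)^(1/q - 1/p) (G^r)^(1/r - 1/p)]. *)
Lemma discrete_young {R : realType} {n : nat} {p q r : R} {F G H : 'I_n.+1 -> R} :
  1 < q -> 1 < r -> 0 < p -> p^-1 = q^-1 + r^-1 - 1 ->
  (forall j, 0 <= F j) -> (forall j, 0 <= G j) -> (forall j, 0 <= H j) ->
  (forall k, H k <= n.+1%:R^-1 * \sum_j F j * G (k - j)) ->
  n.+1%:R^-1 * \sum_k H k `^ p <=
    (n.+1%:R^-1 * \sum_j F j `^ q) `^ (p / q)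
    * (n.+1%:R^-1 * \sum_j G j `^ r) `^ (p / r).
Proof.
move=> q1 r1 p0 pqr F0 G0 H0 HFG.
have q0 : 0 < q by apply: lt_trans q1.
have r0 : 0 < r by apply: lt_trans r1.
have [pn qn rn] : [/\ p != 0, q != 0 & r != 0] by rewrite !gt_eqF.
have s0 : 0 < p^-1 by rewrite invr_gt0.
have t0 : 0 < q^-1 - p^-1.
  by rewrite pqr -addrA opprD addrA subrr sub0r opprB subr_gt0 invf_lt1.
have u0 : 0 < r^-1 - p^-1.
  by rewrite pqr (_ : _ - _ = 1 - q^-1) ?subr_gt0 ?invf_lt1//; ring.
have stu : p^-1 + (q^-1 - p^-1) + (r^-1 - p^-1) = 1 by rewrite pqr; ring.
set m : R := n.+1%:R; have m0 : 0 < m by rewrite ltr0n.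
set SF := \sum_j F j `^ q; set SG := \sum_j G j `^ r.
have SF0 : 0 <= SF by apply: sumr_ge0 => j _; exact: powR_ge0.
have SG0 : 0 <= SG by apply: sumr_ge0 => j _; exact: powR_ge0.
(* The map [j => k - j] permutes Z/(n+1). *)
have SGk k : \sum_j G (k - j) `^ r = SG.
  rewrite /SG [RHS](reindex_inj (h := fun j => k - j))// => i j /addrI.
  exact: oppr_inj.
pose X k := \sum_j F j `^ q * G (k - j) `^ r.
have X0 k : 0 <= X k by apply: sumr_ge0 => j _; rewrite mulr_ge0 ?powR_ge0.
have HX k : H k `^ p <= m `^ (- p) *
    (X k * SF `^ (p / q - 1) * SG `^ (p / r - 1)).
  have h : \sum_j F j * G (k - j) <=
      X k `^ p^-1 * SF `^ (q^-1 - p^-1) * SG `^ (r^-1 - p^-1).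
    rewrite -(SGk k); apply: le_trans (sum_hoelder3 s0 t0 u0 stu _ _ _);
      last 3 first.
    - by move=> j; rewrite mulr_ge0 ?powR_ge0.
    - by move=> j; exact: powR_ge0.
    - by move=> j; exact: powR_ge0.
    apply: ler_sum => j _; rewrite powRM ?powR_ge0// -!powRrM.
    rewrite -[leRHS]mulrA [leRHS]mulrACA -!powRD; last 2 first.
    (* Adding exponents over a possibly zero base requires their sum to be nonzero; here it is 1. *)
    + by apply/implyP; rewrite -mulrDr addrC subrK divff// oner_eq0.
    + by apply/implyP; rewrite -mulrDr addrC subrK divff// oner_eq0.
    by rewrite -!mulrDr ![p^-1 + _]addrC !subrK !divff// !powRr1.
  have mV0 : 0 <= m^-1 by rewrite invr_ge0 ltW.
  have hk := le_trans (HFG k) (ler_wpM2l mV0 h).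
  have rhs0 : 0 <= m^-1 * (X k `^ p^-1 * SF `^ (q^-1 - p^-1) * SG `^ (r^-1 - p^-1)).
    exact: le_trans hk.
  apply: (le_trans (ge0_ler_powR (ltW p0) (H0 k) rhs0 hk)).
  rewrite !powRM ?mulr_ge0 ?powR_ge0// -!powRrM mulVf// powRr1//.
  by rewrite -powR_inv1 ?(ltW m0)// -powRrM mulN1r !mulrBl mulVf// ![_^-1 * p]mulrC.
have sumX : \sum_k X k = SF * SG.
  rewrite exchange_big/= mulr_suml; apply: eq_bigr => j _.
  rewrite -mulr_sumr; congr (_ * _); rewrite /SG.
  by rewrite [RHS](reindex_inj (h := fun k => k - j))// => i k /addIr.
apply: (@le_trans _ _ (m^-1 * (m `^ (- p) *
    (SF * SG * SF `^ (p / q - 1) * SG `^ (p / r - 1))))).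
  rewrite ler_wpM2l ?invr_ge0 ?(ltW m0)//.
  apply: le_trans (ler_sum _ (fun k _ => HX k)) _.
  by rewrite -mulr_sumr -!mulr_suml sumX.
rewrite !powRM ?invr_ge0 ?(ltW m0)//.
(* The normalising factors balance exactly because [1 + p = p / q + p / r]. *)
have mE : m^-1 * m `^ (- p) = m^-1 `^ (p / q) * m^-1 `^ (p / r).
  rewrite -powR_inv1 ?(ltW m0)// -!powRrM -!powRD ?(gt_eqF m0) ?implybT//.
  congr (_ `^ _); have := congr1 (fun x => p * x) pqr.
  by rewrite divff// mulrBr mulrDr mulr1 => H1; rewrite !mulN1r; lra.
have E x v : 0 <= x -> 1 < v -> v < p -> x * x `^ (p / v - 1) = x `^ (p / v).
  by move=> x0 v1 vp; apply: mulr_powRB1 => //; rewrite divr_gt0// (lt_trans _ v1).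
have pq : q < p by rewrite -ltf_pV2 ?posrE// -subr_gt0.
have pr : r < p by rewrite -ltf_pV2 ?posrE// -subr_gt0.
rewrite -(E SF)// -(E SG)// [leLHS]mulrA mE.
by rewrite le_eqVlt; apply/orP; left; apply/eqP; ring.
Qed.

(** * The character [e]: homomorphism, roots of unity, Lipschitz bound *)

Section exponential.
Context {R : realType}.
Implicit Types (x y : R).

Lemma eD x y : e (x + y) = e x * e y.
Proof.
rewrite /e mulrDr cosD sinD; apply/eqP; rewrite eq_complex/= eqxx/=.
by rewrite addrC; apply/eqP; ring.
Qed.

Lemma e0 : e (0 : R) = 1.
Proof. by rewrite /e mulr0 cos0 sin0. Qed.

Lemma e1 : e (1 : R) = 1.
Proof. by rewrite /e mulr1 mulr_natl cos2pi sin2pi. Qed.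

Lemma eXn (n : nat) x : e (n%:R * x) = e x ^+ n.
Proof.
elim: n => [|n IH]; first by rewrite mul0r e0.
by rewrite -natr1 mulrDl mul1r eD IH exprSr.
Qed.

Lemma normc_e x : Normc.normc (e x) = 1.
Proof. by rewrite /= cos2Dsin2 sqrtr1. Qed.

(** The real part is already different from 1: it is [1 - 2 sin(pi x)^2], and the sine is positive
    on the open interval. *)
Lemma e_neq1 x : 0 < x < 1 -> e x != 1.
Proof.
move=> /andP[x0 x1]; rewrite /e eq_complex/= negb_and; apply/orP; left.
rewrite -mulrA mulr_natl cos_mulr2n cos2sin2 lt_eqF//.
have : 0 < sin (pi * x) ^+ 2.
  rewrite exprn_gt0// sin_gt0_pi// mulr_gt0 ?pi_gt0//=.
  by rewrite gtr_pMr ?pi_gt0.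
rewrite mulr2n; lra.
Qed.

Lemma e_prim_root (n : nat) : n.+1.-primitive_root (e (n.+1%:R^-1 : R)).
Proof.
apply/andP; split => //; apply/forallP => i; apply/eqP.
rewrite unity_rootE -eXn; have [->|ni] := eqVneq i.+1 n.+1.
  by rewrite divff ?pnatr_eq0// e1 eqxx.
apply/negbTE/e_neq1; rewrite divr_gt0//= ltr_pdivrMr ?ltr0n// mul1r ltr_nat.
by rewrite ltn_neqAle ni/=.
Qed.

Lemma ler_normc_sum (I : Type) (s : seq I) (P : pred I) (f : I -> R[i]) :
  Normc.normc (\sum_(i <- s | P i) f i) <= \sum_(i <- s | P i) Normc.normc (f i).
Proof.
elim/big_ind2: _ => [|x1 x2 y1 y2 h1 h2|//]; first by rewrite Normc.normc0.
exact: le_trans (le_normcD _ _) (lerD h1 h2).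
Qed.

Lemma derive_le1_lipschitz (f df : R -> R) :
  (forall x, is_derive x 1 f (df x)) -> (forall x, `|df x| <= 1) ->
  forall x y, `|f x - f y| <= `|x - y|.
Proof.
move=> fd df1 x y; wlog yx : x y / y <= x.
  by move=> H; have /orP[/H|/H//] := le_total x y; rewrite distrC (distrC x).
have cf : {within `[y, x], continuous f}.
  apply: continuous_subspaceT => z; apply: differentiable_continuous.
  by apply/derivable1_diffP; case: (fd z).
have [c _ ->] := MVT_segment yx (fun z _ => fd z) cf.
by rewrite normrM ler_piMl.
Qed.

(** The real and imaginary parts each contribute [2 * pi], the modulus being at most the sum of
    their absolute values. *)
Lemma e_lipschitz x y : Normc.normc (e x - e y) <= 4 * pi * `|x - y|.
Proof.
have h z t : `|2 * pi * z - 2 * pi * t| = 2 * pi * `|z - t| :> R.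
  by rewrite -mulrBr normrM ger0_norm// mulr_ge0// pi_ge0.
have hc : `|cos (2 * pi * x) - cos (2 * pi * y)| <= 2 * pi * `|x - y|.
  rewrite -h; apply: (@derive_le1_lipschitz cos (fun x => - sin x)) => z.
  by rewrite normrN; exact: sin_max.
have hs : `|sin (2 * pi * x) - sin (2 * pi * y)| <= 2 * pi * `|x - y|.
  by rewrite -h; apply: (@derive_le1_lipschitz sin cos) => z; exact: cos_max.
rewrite /e /=; set a := cos _ - cos _; set b := sin _ - sin _.
apply: (@le_trans _ _ (`|a| + `|b|)).
  rewrite -[leRHS]ger0_norm ?addr_ge0// -[leRHS]sqrtr_sqr ler_wsqrtr//.
  rewrite [leRHS]sqrrD !real_normK ?num_real//.
  by rewrite addrAC lerDl mulrn_wge0// mulr_ge0.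
have -> : 4 * pi * `|x - y| = 2 * pi * `|x - y| + 2 * pi * `|x - y| by ring.
exact: lerD.
Qed.

End exponential.

(** * Exponential sums over truncated sets *)

Lemma perm_trunc (D : set nat) (N : nat) :
  perm_eq (trunc D N) [seq n <- iota 1 N | n \in D].
Proof.
apply: uniq_perm; first exact: fset_uniq.
  by rewrite filter_uniq// iota_uniq.
by move=> n; rewrite !inE mem_filter andbC.
Qed.

Lemma counting_fun_le (D : set nat) (N : nat) : (counting_fun D N <= N)%N.
Proof.
rewrite /counting_fun (perm_size (perm_trunc D N)) size_filter.
by rewrite -[leqRHS](size_iota 1 N) count_size.
Qed.

(** Summing over the common list [iota 1 N] with [D] as a filter gives the sums of [A], [B] and
    their intersection the shape needed in [root_unity_convolution]. *)
Lemma exp_sumE {R : realType} (D : set nat) (N : nat) (x : R) :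
  exp_sum D N x = \sum_(n <- iota 1 N | n \in D) e (n%:R * x).
Proof. by rewrite /exp_sum (perm_big _ (perm_trunc D N)) big_filter. Qed.

Lemma normc_ge0 {R : rcfType} (z : R[i]) : 0 <= Normc.normc z.
Proof. by case: z => a b /=; exact: sqrtr_ge0. Qed.

Lemma normc_natr (R : rcfType) (n : nat) : Normc.normc (n%:R : R[i]) = n%:R.
Proof. by rewrite (@normcMn R 1 n) Normc.normc1. Qed.

Lemma normc_exp_sum_le {R : realType} (D : set nat) (N : nat) (x : R) :
  Normc.normc (exp_sum D N x) <= (counting_fun D N)%:R.
Proof.
apply: le_trans (ler_normc_sum _ _ _ _) _.
under eq_bigr do rewrite normc_e.
by rewrite big_const_seq iter_addr_0 count_predT.
Qed.

(** The constant grows with [N], which is harmless: [N] is fixed while the number of sample points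
    tends to infinity. *)
Lemma normc_exp_sum_lipschitz {R : realType} (D : set nat) (N : nat) (x y : R) :
  `|Normc.normc (exp_sum D N x) - Normc.normc (exp_sum D N y)|
    <= (\sum_(n <- trunc D N) 4 * pi * n%:R) * `|x - y|.
Proof.
have h (u v : R) : Normc.normc (exp_sum D N u) - Normc.normc (exp_sum D N v)
    <= (\sum_(n <- trunc D N) 4 * pi * n%:R) * `|u - v|.
  rewrite lerBlDr -{1}[exp_sum D N u](subrK (exp_sum D N v)).
  apply: le_trans (le_normcD _ _) _; rewrite lerD2r /exp_sum -sumrB.
  apply: le_trans (ler_normc_sum _ _ _ _) _.
  rewrite mulr_suml; apply: ler_sum => n _.
  apply: le_trans (e_lipschitz _ _) _.
  by rewrite -mulrBr normrM ger0_norm// mulrA.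
by rewrite ler_norml lerNl opprB h {1}distrC h.
Qed.

Lemma exp_sum_rational {R : realType} (D : set nat) (N n : nat) (k : 'I_n.+1) :
  exp_sum D N (k%:R / n.+1%:R : R)
  = \sum_(a <- iota 1 N | a \in D) e (n.+1%:R^-1 : R) ^+ (a * k).
Proof.
by rewrite exp_sumE; apply: eq_bigr => a _; rewrite mulrA -natrM eXn.
Qed.

(** This is the convolution identity followed by the triangle inequality; [N <= n] keeps the
    frequencies [1..N] distinct modulo [n.+1]. *)
Lemma normc_exp_sumI_le {R : realType} (A B : set nat) (N n : nat) (k : 'I_n.+1) :
  (N <= n)%N ->
  Normc.normc (exp_sum (A `&` B) N (k%:R / n.+1%:R : R))
  <= n.+1%:R^-1 * \sum_(j < n.+1)
       Normc.normc (exp_sum A N (j%:R / n.+1%:R : R))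
     * Normc.normc (exp_sum B N ((k - j)%R%:R / n.+1%:R : R)).
Proof.
move=> Nn; rewrite ler_pdivlMl ?ltr0n// -[X in X * _ <= _]normc_natr.
rewrite -Normc.normcM !exp_sum_rational.
under eq_bigl do rewrite in_setI.
rewrite -(root_unity_convolution _ (e_prim_root n) (iota_uniq _ _)); last first.
  by move=> i; rewrite mem_iota add1n ltnS => /andP[_ /leq_trans]; apply.
apply: le_trans (ler_normc_sum _ _ _ _) _.
by apply: ler_sum => j _; rewrite Normc.normcM -!exp_sum_rational.
Qed.

(** * Moments as limits of Riemann sums, and Young's inequality on the circle *)

Section moments.
Context {R : realType} (p : R) (D : set nat) (N : nat).
Hypothesis p1 : 1 < p.

Let g (x : R) : R := Normc.normc (exp_sum D N x) `^ p.

Let g_lipschitz := @lipschitz_powR R p (counting_fun D N)%:R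
  (\sum_(n <- trunc D N) 4 * pi * n%:R) (fun x => Normc.normc (exp_sum D N x)) p1
  (fun x => introT andP (conj (normc_ge0 _) (normc_exp_sum_le D N x)))
  (normc_exp_sum_lipschitz D N).

Lemma moment_riemann_sum :
  exists2 I : R, moment p D N = I%:E & riemann_sum g M @[M --> \oo] --> I.
Proof.
exists (\int[@lebesgue_measure R]_(x in `[0, 1]) g x).
  rewrite /Rintegral fineK//; apply: integrable_fin_num => //.
  exact: lipschitz_integrable g_lipschitz _ _.
exact: riemann_sum_cvg g_lipschitz.
Qed.

End moments.

(** The strict bounds leave room for the Riemann sums of [A] and [B] to lie below [U] and [V] once
    [M] is large; discrete Young then bounds those of the intersection, and the bound passes to the
    limit. *)
Lemma momentI_le {R : realType} (A B : set nat) (N : nat) (p q r U V : R) :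
  1 < p -> 1 < q -> 1 < r -> p^-1 = q^-1 + r^-1 - 1 ->
  (moment q A N < U%:E)%E -> (moment r B N < V%:E)%E ->
  (moment p (A `&` B) N <= (U `^ (p / q) * V `^ (p / r))%:E)%E.
Proof.
move=> p1 q1 r1 pqr.
have [p0 q0 r0] : [/\ 0 < p, 0 < q & 0 < r] by split; apply: lt_trans ltr01 _.
have [IA -> cA] := @moment_riemann_sum R q A N q1.
have [IB -> cB] := @moment_riemann_sum R r B N r1.
have [ID -> cD] := @moment_riemann_sum R p (A `&` B) N p1.
rewrite !lte_fin lee_fin => AU BV.
have ge0 (f : R -> R) t M : 0 <= riemann_sum (fun x => f x `^ t) M.
  by rewrite mulr_ge0 ?invr_ge0// sumr_ge0// => i _; exact: powR_ge0.
apply: (cvgr_to_le cD); near=> M.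
have SA : riemann_sum (fun x => Normc.normc (exp_sum A N x) `^ q) M <= U.
  by near: M; exact: (cvgr_le IA).
have SB : riemann_sum (fun x => Normc.normc (exp_sum B N x) `^ r) M <= V.
  by near: M; exact: (cvgr_le IB).
have NM : (N < M)%N by near: M; exact: nbhs_infty_gt.
have [n Mn] : exists n, M = n.+1 by exists M.-1; rewrite prednK// (leq_trans _ NM).
rewrite {}Mn ltnS in SA SB NM *.
apply: (@le_trans _ _
  (riemann_sum (fun x => Normc.normc (exp_sum A N x) `^ q) n.+1 `^ (p / q)
  * riemann_sum (fun x => Normc.normc (exp_sum B N x) `^ r) n.+1 `^ (p / r))).
  apply: discrete_young => //; try by move=> j; exact: normc_ge0.
  by move=> k; exact: normc_exp_sumI_le.
rewrite ler_pM ?powR_ge0//.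
  by rewrite ge0_ler_powR ?nnegrE ?divr_ge0 ?(ltW p0) ?(ltW q0)// (le_trans _ SA).
by rewrite ge0_ler_powR ?nnegrE ?divr_ge0 ?(ltW p0) ?(ltW r0)// (le_trans _ SB).
Unshelve. all: by end_near. Qed.

(** * Lower density and the final estimate *)

Lemma positive_lower_density_ge {R : realType} {D : set nat} :
  positive_lower_density R D ->
  exists2 c : R, 0 < c & \forall N \near \oo, c * N%:R <= (counting_fun D N)%:R.
Proof.
rewrite /positive_lower_density limn_einf_lim.
set u := fun N => _; rewrite (cvg_lim _ (@cvg_einfs_sup R u))//.
(* The lower limit is the supremum of the infima over tails, so some tail has a positive infimum. *)
move=> /ereal_sup_gt[_ [n _ <-]].
move=> un0.
have [c c0 cu] : exists2 c : R, 0 < c & (c%:E <= einfs u n)%E.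
  case: (einfs u n) un0 => [c| |]//; first by rewrite lte_fin => c0; exists c.
  (* In the formal case of an infinite infimum any positive real serves as [c]. *)
  by move=> _; exists 1 => //; rewrite leey.
exists c => //; near=> N.
have N0 : (0 < N)%N by near: N; exact: nbhs_infty_gt.
rewrite -ler_pdivlMr ?ltr0n// -lee_fin; apply: le_trans cu _.
apply: ereal_inf_lbound; exists N => //=.
by near: N; exact: nbhs_infty_ge.
Unshelve. all: by end_near. Qed.

Theorem theorem3p6 (R : realType) (A B : set nat) (p q r : R)
    (hA : strongly_subconvex q A) (hq : 1 < q)
    (hB : strongly_subconvex r B) (hr : 1 < r)
    (hp : p^-1 = q^-1 + r^-1 - 1)
    (hd : positive_lower_density R (A `&` B))
    (hqr : 3 / 2 < q^-1 + r^-1 < 2) :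
  strongly_subconvex p (A `&` B).
Proof.
have [q0 r0] : 0 < q /\ 0 < r by split; apply: lt_trans ltr01 _.
(* The two bounds on [q^-1 + r^-1] translate into [1 < p < 2]. *)
have [s1 s2] : 2^-1 < p^-1 /\ p^-1 < 1 by rewrite hp; case/andP : hqr; lra.
have p0 : 0 < p by rewrite -invr_gt0 (lt_trans _ s1).
have p1 : 1 < p by rewrite -invf_lt1.
have p2 : p < 2 by rewrite -ltf_pV2 ?posrE.
have [_ _ [C1 C10 hC1]] := hA; have [_ _ [C2 C20 hC2]] := hB.
have [c c0 hc] := positive_lower_density_ge hd.
split.
(* Positive density makes some truncation of the intersection non-empty. *)
- near \oo => N; have : c * N%:R <= (counting_fun (A `&` B) N)%:R by near: N.
  have N0 : (0 < N)%N by near: N; exact: nbhs_infty_gt.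
  move/(lt_le_trans (mulr_gt0 c0 (_ : 0 < N%:R))); rewrite !ltr0n => /(_ N0).
  rewrite /counting_fun cardfs_gt0 => /fset0Pn[n].
  by rewrite !inE/= => /andP[_ /set_mem nAB]; exists n.
- by rewrite p0.
exists ((2 * C1) `^ (p / q) * (2 * C2) `^ (p / r) * c^-1 `^ p).
  by rewrite !mulr_gt0 ?powR_gt0 ?invr_gt0 ?mulr_gt0.
near=> N.
have N0 : (0 < N)%N by near: N; exact: nbhs_infty_gt.
have Nr : 0 < N%:R :> R by rewrite ltr0n.
(* The count of [E] is bounded trivially by [N]; the factor 2 provides the strict inequality that
   [momentI_le] asks for. *)
have bound (E : set nat) (C t : R) : 1 < t -> 0 < C ->
    (moment t E N <= (C * N%:R^-1 * (counting_fun E N)%:R `^ t)%:E)%E ->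
    (moment t E N < (2 * C * N%:R `^ (t - 1))%:E)%E.
  move=> t1 C0 /le_lt_trans; apply; rewrite lte_fin.
  have t0 : 0 < t by apply: lt_trans t1.
  apply: (@le_lt_trans _ _ (C * N%:R `^ (t - 1))).
    rewrite -mulrA ler_pM2l// mulrC ler_pdivrMr// mulrC.
    rewrite mulr_powRB1// ?(ltW Nr)// ge0_ler_powR ?nnegrE ?(ltW t0)//.
    by rewrite ler_nat counting_fun_le.
  by rewrite -mulrA ltr_pMl ?ltr1n// mulr_gt0// powR_gt0.
have hN : (moment p (A `&` B) N <= ((2 * C1 * N%:R `^ (q - 1)) `^ (p / q)
    * (2 * C2 * N%:R `^ (r - 1)) `^ (p / r))%:E)%E.
  by apply: momentI_le => //; apply: bound => //; near: N.
apply: le_trans hN _; rewrite lee_fin.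
rewrite !powRM ?powR_ge0 ?mulr_ge0 ?(ltW C10) ?(ltW C20)//.
(* The exponents add up to [p * (2 - q^-1 - r^-1) = p * (1 - p^-1) = p - 1]. *)
have pN : N%:R `^ (q - 1) `^ (p / q) * N%:R `^ (r - 1) `^ (p / r)
    = N%:R^-1 * N%:R `^ p :> R.
  rewrite -(mulr_powRB1 (ltW Nr) p0) mulKf ?(gt_eqF Nr)//.
  rewrite -!powRrM -powRD ?(gt_eqF Nr) ?implybT//; congr (_ `^ _).
  have := congr1 (fun x => p * x) hp; rewrite divff ?(gt_eqF p0)// => pE.
  have -> : p - 1 = p - p * (q^-1 + r^-1 - 1) by rewrite -pE.
  by field; rewrite !gt_eqF.
have cN : N%:R `^ p <= c^-1 `^ p * (counting_fun (A `&` B) N)%:R `^ p.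
  rewrite -powRM ?invr_ge0 ?(ltW c0)// ge0_ler_powR ?nnegrE ?(ltW p0) ?(ltW Nr)//.
    by rewrite mulr_ge0// invr_ge0 ltW.
  by rewrite ler_pdivlMl//; near: N.
rewrite mulrACA pN -!mulrA !ler_wpM2l ?powR_ge0//.
by rewrite mulrCA ler_wpM2l// invr_ge0 ltW.
Unshelve. all: by end_near. Qed.
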